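(* Let $M$ be the Kodaira-Thurston surface with the complex structure $J$ described in the context, and let $$\omega = \frac{i}{2}\, r(x,y)\, \varphi^{1}\wedge\overline{\varphi^{1}} + \frac{i}{2}\, s\, \varphi^{2}\wedge\overline{\varphi^{2}} + \frac12\left(u(x,y)\, \varphi^{1}\wedge\overline{\varphi^{2}} - \overline{u(x,y)}\, \varphi^{2}\wedge\overline{\varphi^{1}}\right)$$ be the fundamental form of a $T^2$-invariant pluriclosed Hermitian metric $g$ on $(M,J)$ (with $s$ a constant), and write $u=u_1+iu_2$ with $u_1,u_2$ real-valued. Then $\omega$ is Vaisman if and only if the functions $$h_3 = \frac{s}{rs-|u|^2}\left(-s-(u_1)_x-(u_2)_y\right),\qquad h_4=\frac{s}{rs-|u|^2}\left((u_1)_y-(u_2)_x\right)$$ are both constant. Moreover, if $\omega$ is Vaisman with Lee form $\theta$, then the Lee vector field $T$ is given by $$T=\frac{h_3}{s}\,e_3+\frac{h_4}{s}\,e_4,$$ and $$d(J\theta) = -\frac{1}{s^2}\,(h_3^2+h_4^2)\,(rs-|u|^2)\, e^1\wedge e^2 .$$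
   Context: The Kodaira-Thurston surface is the compact $4$-manifold $M=\mathrm{Nil}^3/\Gamma\times S^1$, where $\mathrm{Nil}^3$ is the real Heisenberg group of matrices $\begin{pmatrix}1&x&z\\0&1&y\\0&0&1\end{pmatrix}$, $x,y,z\in\mathbb R$, and $\Gamma$ is the lattice of such matrices with integer entries; $w$ denotes the coordinate on the $S^1=\mathbb R/\mathbb Z$ factor. Smooth functions on $M$ are the smooth functions $f$ on $\mathbb R^4$ with $f(x+j,y+k,z+jy+m,w+n)=f(x,y,z,w)$ for all $(j,k,m,n)\in\mathbb Z^4$. A global coframe on $M$ is $$e^1=dy,\quad e^2=dx,\quad e^3=dw,\quad e^4=dz-x\,dy,$$ with $de^1=de^2=de^3=0$, $de^4=e^1\wedge e^2$, and dual frame $e_1=\partial_y+x\partial_z$, $e_2=\partial_x$, $e_3=\partial_w$, $e_4=\partial_z$. The complex structure $J$ is the one for which $\varphi^1=e^1+ie^2$ and $\varphi^2=e^3+ie^4$ form a global frame of $(1,0)$-forms; on vectors $Je_1=e_2$, $Je_3=e_4$, and the action on $1$-forms is $Je^1=e^2$, $Je^2=-e^1$, $Je^3=e^4$, $Je^4=-e^3$. $M$ is a principal $T^2$-bundle over the torus $T^2_{xy}$, with fibre coordinates $z,w$. A $T^2$-invariant form is one whose coefficients in the coframe $e^1,\dots,e^4$ depend only on $(x,y)$. A $T^2$-invariant Hermitian metric $g$ has fundamental form $$\omega = r\,e^{1}\wedge e^2+s\,e^3\wedge e^4+u_1(e^1\wedge e^3+e^2\wedge e^4)+u_2(e^1\wedge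 e^4-e^2\wedge e^3)$$ (equal to the expression in $\varphi^1,\varphi^2$ with $u=u_1+iu_2$), where $r,s$ are smooth real functions and $u$ is a smooth complex function of $(x,y)$ with $r>0$, $s>0$, $rs>|u|^2$. Here $g(X,Y)=\omega(X,JY)$, i.e. $g(e_1,e_1)=g(e_2,e_2)=r$, $g(e_3,e_3)=g(e_4,e_4)=s$, $g(e_1,e_3)=g(e_2,e_4)=u_2$, $g(e_1,e_4)=-u_1=-g(e_2,e_3)$, $g(e_1,e_2)=g(e_3,e_4)=0$. Subscripts $x,y$ on functions denote partial derivatives. A Hermitian metric is pluriclosed if $\partial\overline\partial\omega=0$. In complex dimension $2$ the Lee form $\theta$ is the unique $1$-form with $d\omega=\theta\wedge\omega$; the metric (or $\omega$) is Vaisman if $d\theta=0$ and $\nabla^{LC}\theta=0$, where $\nabla^{LC}$ is the Levi-Civita connection of $g$. The Lee vector field $T$ is the vector field $g$-dual to $\theta$, i.e. $g(T,X)=\theta(X)$ for all $X$. *)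

(* Defs.v *)
From HB Require Import structures.
From mathcomp Require Import all_boot all_order all_algebra.
From mathcomp Require Import complex.
From mathcomp Require Import all_classical all_reals all_analysis.
Set Implicit Arguments.
Unset Strict Implicit.
Unset Printing Implicit Defensive.
Import Order.TTheory GRing.Theory Num.Theory.
Import numFieldNormedType.Exports.
Local Open Scope ring_scope.

(* The Kodaira-Thurston surface M is the quotient of R^4, with coordinates
   (x, y, z, w), by the deck transformations [deck] below.  Functions, forms,
   vector fields and metrics on M are represented by their lifts to R^4;
   tensors are given by their components in the coordinates (x, y, z, w), and
   such a tensor is smooth on M iff its coefficients in the global frame
   [frame] are smooth functions on M. *)

Definition ix : 'I_4 := @Ordinal 4 0 isT.
Definition iy : 'I_4 := @Ordinal 4 1 isT.
Definition iz : 'I_4 := @Ordinal 4 2 isT.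
Definition iw : 'I_4 := @Ordinal 4 3 isT.

Section Functions.
Variable R : realType.
Implicit Types (f : 'rV[R]_4 -> R) (p : 'rV[R]_4).

Definition cx p : R := p 0 ix.
Definition cy p : R := p 0 iy.
Definition cz p : R := p 0 iz.
Definition cw p : R := p 0 iw.

Definition dd (i : 'I_4) : 'rV[R]_4 := delta_mx 0 i.

Definition partial (i : 'I_4) f : 'rV[R]_4 -> R := fun p => derive f p (dd i).

(* C^infinity: all iterated partial derivatives are differentiable
   (hence continuous) everywhere. *)
Definition smooth f : Prop :=
  forall (l : seq 'I_4) p, differentiable (foldr partial f l) p.

Definition deck (j k m n : int) p : 'rV[R]_4 :=
  \row_i [:: cx p + j%:~R; cy p + k%:~R;
             cz p + j%:~R * cy p + m%:~R; cw p + n%:~R]`_i.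

Definition smooth_on_M f : Prop :=
  smooth f /\ forall j k m n p, f (deck j k m n p) = f p.

Definition depends_on_xy f : Prop :=
  forall p q, cx p = cx q -> cy p = cy q -> f p = f q.

End Functions.

Section Forms.
Variable R : realType.
Implicit Types (K : comNzRingType) (p v : 'rV[R]_4).

(* A k-form a, with values in K, is given by
   a p I = a_p (d/dx_(I 0), ..., d/dx_(I (k-1))). *)
Definition dform K (k : nat) := 'rV[R]_4 -> {ffun 'I_k -> 'I_4} -> K.

Definition omit k (j : 'I_k.+1) (I : {ffun 'I_k.+1 -> 'I_4}) :
  {ffun 'I_k -> 'I_4} := [ffun m => I (lift j m)].

(* Wedge product of a 1-form with a k-form, normalized so that
   (a /\ b)(X, Y) = a(X) b(Y) - a(Y) b(X) when k = 1. *)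
Definition wedge1 K k (a : dform K 1) (b : dform K k) : dform K k.+1 :=
  fun p I => \sum_(j < k.+1) (-1) ^+ j * a p [ffun=> I j] * b p (omit j I).

Definition ext_d k (a : dform R k) : dform R k.+1 :=
  fun p I => \sum_(j < k.+1) (-1) ^+ j * partial (I j) (a^~ (omit j I)) p.

Definition eval1 (a : dform R 1) p v : R := \sum_i v 0 i * a p [ffun=> i].

Definition form_add K k (a b : dform K k) : dform K k := fun p I => a p I + b p I.
Definition form_scale K k (f : 'rV[R]_4 -> K) (a : dform K k) : dform K k :=
  fun p I => f p * a p I.

End Forms.

Declare Scope dform_scope.
Delimit Scope dform_scope with DF.
Infix "+" := form_add : dform_scope.
Infix "**" := form_scale (at level 40, left associativity) : dform_scope.
Infix "/\" := wedge1 : dform_scope.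

Section Frame.
Variable R : realType.
Implicit Types p v : 'rV[R]_4.

Definition vec1 p : 'rV[R]_4 := dd R iy + cx p *: dd R iz.
Definition vec2 p : 'rV[R]_4 := dd R ix.
Definition vec3 p : 'rV[R]_4 := dd R iw.
Definition vec4 p : 'rV[R]_4 := dd R iz.

Definition frame (a : 'I_4) p : 'rV[R]_4 :=
  [:: vec1 p; vec2 p; vec3 p; vec4 p]`_a.

Definition dcoord (i : 'I_4) : dform R R 1 := fun p I => (I ord0 == i)%:R.

Definition cov1 : dform R R 1 := dcoord iy.
Definition cov2 : dform R R 1 := dcoord ix.
Definition cov3 : dform R R 1 := dcoord iw.
Definition cov4 : dform R R 1 :=
  form_add (dcoord iz) (form_scale (fun p => - cx p) (dcoord iy)).

(* J e_1 = e_2 and J e_3 = e_4 *)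
Definition J p v : 'rV[R]_4 :=
  eval1 cov1 p v *: vec2 p - eval1 cov2 p v *: vec1 p
  + eval1 cov3 p v *: vec4 p - eval1 cov4 p v *: vec3 p.

(* J e^1 = e^2, J e^2 = - e^1, J e^3 = e^4, J e^4 = - e^3 *)
Definition Jform (a : dform R R 1) : dform R R 1 := fun p I =>
  eval1 a p (vec1 p) * cov2 p I - eval1 a p (vec2 p) * cov1 p I
  + eval1 a p (vec3 p) * cov4 p I - eval1 a p (vec4 p) * cov3 p I.

Definition smooth_form1 (a : dform R R 1) : Prop :=
  forall i, smooth_on_M (fun p => eval1 a p (frame i p)).

End Frame.

Section ComplexForms.
Variable R : realType.
Local Open Scope complex_scope.
Implicit Types p : 'rV[R]_4.

Definition cplx k (a : dform R R k) : dform R R[i] k := fun p I => (a p I)%:C.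
Definition re_form k (a : dform R R[i] k) : dform R R k :=
  fun p I => complex.Re (a p I).
Definition im_form k (a : dform R R[i] k) : dform R R k :=
  fun p I => complex.Im (a p I).
Definition conj_form k (a : dform R R[i] k) : dform R R[i] k :=
  fun p I => (a p I)^*.

Definition ext_dC k (a : dform R R[i] k) : dform R R[i] k.+1 :=
  fun p I => ext_d (re_form a) p I +i* ext_d (im_form a) p I.

Definition phi1 : dform R R[i] 1 := fun p I => cov1 p I +i* cov2 p I.
Definition phi2 : dform R R[i] 1 := fun p I => cov3 p I +i* cov4 p I.

(* d/dx_m-component of the (1,0)-part (X - i J X) / 2, resp. of the
   (0,1)-part (X + i J X) / 2, of the vector X = d/dx_i. *)
Definition proj10 p (i m : 'I_4) : R[i] :=
  2^-1 * ((i == m)%:R - 'i * ((J p (dd R i)) 0 m)%:C).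
Definition proj01 p (i m : 'I_4) : R[i] :=
  2^-1 * ((i == m)%:R + 'i * ((J p (dd R i)) 0 m)%:C).

(* Component of type (q, k - q) of a complex k-form: the sum, over the sets S
   of q argument slots, of a evaluated on the (1,0)-parts of the arguments in S
   and on the (0,1)-parts of the other ones. *)
Definition type_part (q k : nat) (a : dform R R[i] k) : dform R R[i] k :=
  fun p I => \sum_(S : {set 'I_k} | #|S| == q)
    \sum_(L : {ffun 'I_k -> 'I_4})
      (\prod_m (if m \in S then proj10 p (I m) (L m) else proj01 p (I m) (L m)))
      * a p L.

Definition del k (a : dform R R[i] k) : dform R R[i] k.+1 :=
  fun p I => \sum_(q < k.+1) type_part q.+1 (ext_dC (type_part q a)) p I.
Definition delbar k (a : dform R R[i] k) : dform R R[i] k.+1 :=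
  fun p I => \sum_(q < k.+1) type_part q (ext_dC (type_part q a)) p I.

(* (i/2) r phi^1 /\ conj phi^1 + (i/2) s phi^2 /\ conj phi^2
   + (1/2) (u phi^1 /\ conj phi^2 - conj u phi^2 /\ conj phi^1) *)
Definition omega_rsu (r : R -> R -> R) (s : R) (u : R -> R -> R[i]) :
  dform R R[i] 2 :=
  ((fun p => 'i / 2 * (r (cx p) (cy p))%:C) ** (phi1 /\ conj_form phi1)
   + (fun p => 'i / 2 * s%:C) ** (phi2 /\ conj_form phi2)
   + (fun p => 2^-1) **
     ((fun p => u (cx p) (cy p)) ** (phi1 /\ conj_form phi2)
      + (fun p => - (u (cx p) (cy p))^*) ** (phi2 /\ conj_form phi1)))%DF.

End ComplexForms.

Section Metrics.
Variable R : realType.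
Implicit Types (g : 'rV[R]_4 -> 'M[R]_4) (p v : 'rV[R]_4).

Definition gdot g p v (v' : 'rV[R]_4) : R := (v *m g p *m v'^T) 0 0.

Definition hermitian_metric g : Prop :=
  [/\ forall a b, smooth_on_M (fun p => gdot g p (frame a p) (frame b p)),
      forall p v v', gdot g p v v' = gdot g p v' v,
      forall p v, v != 0 -> 0 < gdot g p v v
    & forall p v v', gdot g p (J p v) (J p v') = gdot g p v v'].

Definition T2_invariant g : Prop :=
  forall a b, depends_on_xy (fun p => gdot g p (frame a p) (frame b p)).

(* omega(X, Y) = g(J X, Y), i.e. g(X, Y) = omega(X, J Y) *)
Definition fundamental_form g : dform R R 2 :=
  fun p I => gdot g p (J p (dd R (I ord0))) (dd R (I ord_max)).

Definition pluriclosed g : Prop :=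
  del (delbar (cplx (fundamental_form g))) = fun _ _ => 0.

Definition lee_form g (theta : dform R R 1) : Prop :=
  smooth_form1 theta /\
  ext_d (fundamental_form g) = wedge1 theta (fundamental_form g).

(* Christoffel symbols Gamma^k_ij of the Levi-Civita connection *)
Definition christoffel g p (k i j : 'I_4) : R :=
  2^-1 * \sum_l invmx (g p) k l *
    (partial i (fun q => g q j l) p + partial j (fun q => g q i l) p
     - partial l (fun q => g q i j) p).

(* (nabla_(d/dx_i) theta)(d/dx_j) *)
Definition nabla g (theta : dform R R 1) p (i j : 'I_4) : R :=
  partial i (theta^~ [ffun=> j]) p
  - \sum_k christoffel g p k i j * theta p [ffun=> k].

Definition vaisman g : Prop :=
  exists theta, [/\ lee_form g theta,
    ext_d theta = (fun _ _ => 0)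
  & forall p i j, nabla g theta p i j = 0].

Definition lee_vector_field g (theta : dform R R 1)
    (T : 'rV[R]_4 -> 'rV[R]_4) : Prop :=
  forall p v, gdot g p (T p) v = eval1 theta p v.

End Metrics.

Section Functions_h.
Variable R : realType.
Variables (r : R -> R -> R) (s : R) (u : R -> R -> R[i]).

Definition dx (f : R -> R -> R) (x y : R) : R := derive1 (fun t => f t y) x.
Definition dy (f : R -> R -> R) (x y : R) : R := derive1 (fun t => f x t) y.

Definition u1 (x y : R) : R := complex.Re (u x y).
Definition u2 (x y : R) : R := complex.Im (u x y).

(* r s - |u|^2 *)
Definition disc (x y : R) : R := r x y * s - ComplexField.Normc.normc (u x y) ^+ 2.

Definition h3 (x y : R) : R := s / disc x y * (- s - dx u1 x y - dy u2 x y).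
Definition h4 (x y : R) : R := s / disc x y * (dy u1 x y - dx u2 x y).

Definition constant2 (f : R -> R -> R) : Prop := exists c, forall x y, f x y = c.

End Functions_h.

(* Main.v *)
Require Import Defs.
From mathcomp Require Import all_boot all_order all_algebra.
From mathcomp Require Import complex.
From mathcomp Require Import all_classical all_reals all_analysis.
From mathcomp Require Import ring lra.
Import Order.TTheory GRing.Theory Num.Theory.
Import numFieldNormedType.Exports.
Local Open Scope ring_scope.

(** Since [s] is constant, the only derivatives entering [d omega] are those of
    [u], and
      d omega = A e^123 + B e^124,
      A = - s - (u_1)_x - (u_2)_y,   B = (u_1)_y - (u_2)_x.
    The equation [d omega = theta /\ omega] is then, at each point, a linear
    system of four equations for the four components of [theta].  Its
    determinant is, up to sign, the square of [D = r s - |u|^2], which is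
    positive because [g] is; its solution is the form [g]-dual to the vector
    field
      T = (h_3 / s) e_3 + (h_4 / s) e_4
    ([lee_equationP], [gdot_lee_vector]).  Everything else is read off this
    formula.

    If [theta] is closed, then [h_3] and [h_4] are constant: they are the
    components of [theta] along the fibre directions [w] and [z], the components
    of [theta] do not depend on [z] and [w], so that the mixed components
    of [d theta] are the partial derivatives of [h_3] and [h_4]
    ([closed_lee_constant]).

    Conversely, let [h_3 = c_3] and [h_4 = c_4] be constant.  The remaining
    component of [d theta] is, up to a factor, [c_3 B - c_4 A], which vanishes
    because [s A = c_3 D] and [s B = c_4 D] ([ext_d_lee]).  Moreover [T] is now a
    combination of the coordinate fields of [z] and [w] with constant
    coefficients, hence a Killing field; for the dual of a Killing field
    [nabla theta] is half of [d theta], so it vanishes as well ([nabla_lee]).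

    The last formula is the same computation for [J theta], whose exterior
    derivative is, up to a factor, [c_3 A + c_4 B] ([ext_d_J_lee]). *)

(** * Multi-indices and alternating arrays *)

Section MultiIndices.

Lemma ord4_ind (P : 'I_4 -> Prop) :
  P ix -> P iy -> P iz -> P iw -> forall i, P i.
Proof.
move=> Px Py Pz Pw [[|[|[|[|//]]]] lt_i4].
- by rewrite (_ : Ordinal lt_i4 = ix) //; apply: val_inj.
- by rewrite (_ : Ordinal lt_i4 = iy) //; apply: val_inj.
- by rewrite (_ : Ordinal lt_i4 = iz) //; apply: val_inj.
- by rewrite (_ : Ordinal lt_i4 = iw) //; apply: val_inj.
Qed.

Lemma sum_ord4 (V : nmodType) (F : 'I_4 -> V) :
  \sum_i F i = F ix + F iy + F iz + F iw.
Proof.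
rewrite !big_ord_recl big_ord0 addr0 !addrA.
by do 3?congr (_ + _); congr F; apply: val_inj.
Qed.

Definition mid3 : 'I_3 := lift ord0 ord0.

Lemma sum_ord3 (V : nmodType) (F : 'I_3 -> V) :
  \sum_i F i = F ord0 + F mid3 + F ord_max.
Proof.
rewrite !big_ord_recl big_ord0 addr0 !addrA.
by congr (_ + _ + _); congr F; apply: val_inj.
Qed.

Lemma omit2_0 (I : {ffun 'I_2 -> 'I_4}) : omit ord0 I = [ffun=> I ord_max].
Proof.
by apply/ffunP => m; rewrite !ffunE (ord1 m); congr (I _); apply: val_inj.
Qed.

Lemma omit2_1 (I : {ffun 'I_2 -> 'I_4}) : omit ord_max I = [ffun=> I ord0].
Proof.
by apply/ffunP => m; rewrite !ffunE (ord1 m); congr (I _); apply: val_inj.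
Qed.

Lemma wedge11E (R : realType) (K : comNzRingType) (a b : dform R K 1) p I :
  wedge1 a b p I = a p [ffun=> I ord0] * b p [ffun=> I ord_max]
                   - a p [ffun=> I ord_max] * b p [ffun=> I ord0].
Proof.
rewrite /wedge1 !big_ord_recl big_ord0 addr0 /= expr0 mul1r expr1.
rewrite (_ : lift ord0 ord0 = ord_max); last exact: val_inj.
by rewrite omit2_0 omit2_1 mulN1r mulNr.
Qed.

Lemma ext_d1E (R : realType) (a : dform R R 1) p I :
  ext_d a p I = partial (I ord0) (a^~ [ffun=> I ord_max]) p
                - partial (I ord_max) (a^~ [ffun=> I ord0]) p.
Proof.
rewrite /ext_d !big_ord_recl big_ord0 addr0 /= expr0 mul1r expr1.
rewrite (_ : lift ord0 ord0 = ord_max); last exact: val_inj.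
by rewrite omit2_0 omit2_1 mulN1r.
Qed.

(** The array [B] replaces the dependence of a 2-form on a multi-index, a finite
    function, by two plain indices: the expansions of wedge products and
    exterior derivatives then mention no [omit]. *)
Lemma wedge12E (R : realType) (a : dform R R 1) (b : dform R R 2)
    (B : 'rV[R]_4 -> 'I_4 -> 'I_4 -> R) p I :
    (forall p I, b p I = B p (I ord0) (I ord_max)) ->
  wedge1 a b p I = a p [ffun=> I ord0] * B p (I mid3) (I ord_max)
                   - a p [ffun=> I mid3] * B p (I ord0) (I ord_max)
                   + a p [ffun=> I ord_max] * B p (I ord0) (I mid3).
Proof.
move=> bE; rewrite /wedge1 sum_ord3 /= expr0 mul1r expr1 expr2 mulrNN !mul1r.
rewrite mulN1r mulNr !bE !ffunE.
by congr (_ * B _ _ _ - _ * B _ _ _ + _ * B _ _ _);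
   congr (I _); apply: val_inj.
Qed.

Lemma ext_d2E (R : realType) (b : dform R R 2)
    (B : 'rV[R]_4 -> 'I_4 -> 'I_4 -> R) p I :
    (forall p I, b p I = B p (I ord0) (I ord_max)) ->
  ext_d b p I = partial (I ord0) (fun q => B q (I mid3) (I ord_max)) p
                - partial (I mid3) (fun q => B q (I ord0) (I ord_max)) p
                + partial (I ord_max) (fun q => B q (I ord0) (I mid3)) p.
Proof.
move=> bE; rewrite /ext_d sum_ord3 /= expr0 mul1r expr1 expr2 mulrNN !mul1r.
rewrite mulN1r.
have omitE j : b^~ (omit j I) =
    fun q => B q (I (lift j ord0)) (I (lift j ord_max)).
  by apply/funext => q; rewrite bE !ffunE.
have E01 : lift ord0 ord_max = ord_max :> 'I_3 by exact: val_inj.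
have E10 : lift mid3 ord0 = ord0 by exact: val_inj.
have E11 : lift mid3 ord_max = ord_max by exact: val_inj.
have E20 : lift ord_max ord0 = ord0 :> 'I_3 by exact: val_inj.
have E21 : lift ord_max ord_max = mid3 by exact: val_inj.
by rewrite !omitE E01 E10 E11 E20 E21.
Qed.

(** Forms are indexed here by all multi-indices, not only the increasing ones;
    this lemma and the next reduce an equality of forms to the increasing
    multi-indices. *)
Lemma alternating2_eq0 (R : realDomainType) (F : 'I_4 -> 'I_4 -> R) :
    (forall i j, F i j = - F j i) ->
    F ix iy = 0 -> F ix iz = 0 -> F ix iw = 0 ->
    F iy iz = 0 -> F iy iw = 0 -> F iz iw = 0 ->
  forall i j, F i j = 0.
Proof.
move=> alt Fxy Fxz Fxw Fyz Fyw Fzw.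
have F0 i : F i i = 0 by have := alt i i; lra.
by apply: ord4_ind; apply: ord4_ind => //; rewrite alt; apply/eqP;
   rewrite oppr_eq0; apply/eqP.
Qed.

Lemma alternating3_eq0 (R : realDomainType) (F : 'I_4 -> 'I_4 -> 'I_4 -> R) :
    (forall i j k, F i j k = - F j i k) ->
    (forall i j k, F i j k = - F i k j) ->
    F ix iy iz = 0 -> F ix iy iw = 0 -> F ix iz iw = 0 -> F iy iz iw = 0 ->
  forall i j k, F i j k = 0.
Proof.
move=> alt12 alt23 Fxyz Fxyw Fxzw Fyzw.
have F12 i k : F i i k = 0 by have := alt12 i i k; lra.
have F23 i k : F i k k = 0 by have := alt23 i k k; lra.
have F13 i k : F i k i = 0 by rewrite alt12 F23 oppr0.
have C12 i j k : F j i k = 0 -> F i j k = 0.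
  by move=> Fjik; rewrite alt12 Fjik oppr0.
have C23 i j k : F i k j = 0 -> F i j k = 0.
  by move=> Fikj; rewrite alt23 Fikj oppr0.
(* Every triple of distinct indices is sorted by at most three swaps. *)
by do 3!apply: ord4_ind; rewrite ?F12 ?F23 ?F13 //; auto.
Qed.

End MultiIndices.

(** * Functions of x and y *)

Section Derivability.
Context {R : realType}.
Implicit Types (f h : R -> R) (F : R -> R -> R).

(** The next five lemmas have the functions in beta-expanded form, in which they
    unify at once with the polynomial expressions treated below. *)
Lemma derivable_add {f h x} : derivable f x 1 -> derivable h x 1 ->
  derivable (fun t => f t + h t) x 1.
Proof. exact: derivableD. Qed.

Lemma derivable_mul {f h x} : derivable f x 1 -> derivable h x 1 ->
  derivable (fun t => f t * h t) x 1.
Proof. exact: derivableM. Qed.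

Lemma derivable_opp {f x} : derivable f x 1 -> derivable (fun t => - f t) x 1.
Proof. exact: derivableN. Qed.

Lemma derivable_const (c x : R) : derivable (fun=> c) x 1.
Proof. exact: derivable_cst. Qed.

Lemma derivable_var (x : R) : derivable (fun t : R => t) x 1.
Proof. exact: derivable_id. Qed.

Definition derivable_xy F : Prop :=
  (forall x y, derivable (fun t => F t y) x 1) /\
  (forall x y, derivable (fun t => F x t) y 1).

Lemma derive1_lincomb (a b c d : R) f h t :
    derivable f t 1 -> derivable h t 1 ->
  derive1 (fun t => a * f t + b * h t + c * t + d) t =
    a * derive1 f t + b * derive1 h t + c.
Proof.
move=> df dh; rewrite !derive1E.
have /derivableP If := df; have /derivableP Ih := dh.
have Ia : is_derive t 1 (a \*: f + b \*: h + c \*: id + cst d)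
    (a *: 'D_1 f t + b *: 'D_1 h t + c *: 1 + 0) by exact: is_derive_eq.
by rewrite (_ : (fun t => _) = a \*: f + b \*: h + c \*: id + cst d) //
     (derive_val (is_derive := Ia)) addr0 [c *: 1]mulr1.
Qed.

Lemma dx_lincomb (a b c : R) F1 F2 x y : derivable_xy F1 -> derivable_xy F2 ->
  dx (fun x y => a * F1 x y + b * F2 x y + c * x) x y =
    a * dx F1 x y + b * dx F2 x y + c.
Proof.
move=> [F1x _] [F2x _]; rewrite -(derive1_lincomb a b c 0) //.
rewrite /dx; apply: (congr1 (fun d : R -> R => derive1 d x)).
by apply/funext => t; rewrite addr0.
Qed.

Lemma dy_lincomb (a b c : R) F1 F2 x y : derivable_xy F1 -> derivable_xy F2 ->
  dy (fun x y => a * F1 x y + b * F2 x y + c * x) x y =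
    a * dy F1 x y + b * dy F2 x y.
Proof.
move=> [_ F1y] [_ F2y].
have -> : a * dy F1 x y + b * dy F2 x y =
          a * dy F1 x y + b * dy F2 x y + 0 by rewrite addr0.
rewrite -(derive1_lincomb a b 0 (c * x)) //.
rewrite /dy; apply: (congr1 (fun d : R -> R => derive1 d y)).
by apply/funext => t; rewrite mul0r addr0.
Qed.

Lemma grad_eq0_constant F : derivable_xy F ->
    (forall x y, dx F x y = 0) -> (forall x y, dy F x y = 0) ->
  constant2 F.
Proof.
move=> [derx dery] dx0 dy0; exists (F 0 0) => x y.
have -> : F x y = F 0 y.
  apply: (@is_derive_0_is_cst _ (fun t => F t y)) => t.
  by apply: DeriveDef => //; rewrite -derive1E; exact: dx0.
apply: (@is_derive_0_is_cst _ (fun t => F 0 t)) => t.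
by apply: DeriveDef => //; rewrite -derive1E; exact: dy0.
Qed.

End Derivability.

(* The rules are selected on the syntax of the function: unification up to
   conversion with the wrong rule would unfold the operations of the field. *)
Ltac derivable_poly :=
  lazymatch goal with
  | dF : derivable_xy ?F |- derivable (fun t => ?F t _) _ _ => exact (dF.1 _ _)
  | dF : derivable_xy ?F |- derivable (fun t => ?F _ t) _ _ => exact (dF.2 _ _)
  | |- derivable (fun t => t) _ _ => exact (derivable_var _)
  | |- derivable (fun=> ?c) _ _ => exact (derivable_const _ _)
  | |- derivable (fun t => @?A t + @?B t) _ _ =>
      refine (@derivable_add _ A B _ _ _); derivable_poly
  | |- derivable (fun t => @?A t * @?B t) _ _ =>
      refine (@derivable_mul _ A B _ _ _); derivable_poly
  | |- derivable (fun t => - @?A t) _ _ =>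
      refine (@derivable_opp _ A _ _); derivable_poly
  end.

(** * Invariant functions and forms on the total space *)

Section InvariantFunctions.
Context {R : realType}.
Implicit Types (f h : 'rV[R]_4 -> R) (F : R -> R -> R) (p : 'rV[R]_4).

Lemma cx_shift p (t : R) i : cx (t *: dd R i + p) = (i == ix)%:R * t + cx p.
Proof. by rewrite /cx !mxE eqxx mulrC eq_sym. Qed.

Lemma cy_shift p (t : R) i : cy (t *: dd R i + p) = (i == iy)%:R * t + cy p.
Proof. by rewrite /cy !mxE eqxx mulrC eq_sym. Qed.

(** For this lemma and the next [F] may be arbitrary: the difference quotients
    on the two sides are the same function. *)
Lemma partial_x F p :
  partial ix (fun q => F (cx q) (cy q)) p = dx F (cx p) (cy p).
Proof.
rewrite /partial /derive /dx /derive1.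
apply: (congr1 (fun d : R -> R => lim (d @ 0^')%classic)).
by apply/funext => t /=; rewrite cx_shift cy_shift /= mul1r mul0r add0r.
Qed.

Lemma partial_y F p :
  partial iy (fun q => F (cx q) (cy q)) p = dy F (cx p) (cy p).
Proof.
rewrite /partial /derive /dy /derive1.
apply: (congr1 (fun d : R -> R => lim (d @ 0^')%classic)).
by apply/funext => t /=; rewrite cx_shift cy_shift /= mul1r mul0r add0r.
Qed.

Lemma partial_fibre F p i : i != ix -> i != iy ->
  partial i (fun q => F (cx q) (cy q)) p = 0.
Proof.
move=> /negPf iNx /negPf iNy; rewrite /partial /derive.
have -> : (fun t : R => t^-1 *:
    (((fun q => F (cx q) (cy q)) \o shift p) (t *: dd R i) - F (cx p) (cy p)))
    = cst 0.
  apply/funext => t /=; rewrite cx_shift cy_shift iNx iNy !mul0r !add0r subrr.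
  exact: scaler0.
exact: lim_cst.
Qed.

Definition at_xy (x y : R) : 'rV[R]_4 := x *: dd R ix + y *: dd R iy.

Lemma cx_at x y : cx (at_xy x y) = x.
Proof. by rewrite /cx !mxE /=; ring. Qed.

Lemma cy_at x y : cy (at_xy x y) = y.
Proof. by rewrite /cy !mxE /=; ring. Qed.

Lemma differentiable_derivable_xy F :
    (forall p, differentiable (fun q => F (cx q) (cy q)) p) ->
  derivable_xy F.
Proof.
move=> dF; split=> x y; pose p := at_xy x y.
  have := diff_derivable (v := dd R ix) (dF p); rewrite /derivable.
  set d := (X in (X @ _)%classic); set d' := (X in _ -> cvg (X @ _)%classic).
  suff -> : d = d' by [].
  rewrite /d /d'; apply/funext => t /=.
  by rewrite cx_shift cy_shift cx_at cy_at /= mul1r mul0r add0r [t%:A]mulr1.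
have := diff_derivable (v := dd R iy) (dF p); rewrite /derivable.
set d := (X in (X @ _)%classic); set d' := (X in _ -> cvg (X @ _)%classic).
suff -> : d = d' by [].
rewrite /d /d'; apply/funext => t /=.
by rewrite cx_shift cy_shift cx_at cy_at /= mul1r mul0r add0r [t%:A]mulr1.
Qed.

Lemma partial_lincomb (a b : R) F1 F2 i p :
    derivable_xy F1 -> derivable_xy F2 ->
  partial i (fun q => a * F1 (cx q) (cy q) + b * F2 (cx q) (cy q)) p =
    a * partial i (fun q => F1 (cx q) (cy q)) p
    + b * partial i (fun q => F2 (cx q) (cy q)) p.
Proof.
move=> [F1x F1y] [F2x F2y].
have e (f h : R -> R) : (fun t => a * f t + b * h t) =
    (fun t => a * f t + b * h t + 0 * t + 0).
  by apply/funext => t; rewrite mul0r !addr0.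
move: i; apply: ord4_ind.
- rewrite (partial_x (fun x y => a * F1 x y + b * F2 x y)) !partial_x /dx.
  by rewrite e derive1_lincomb // addr0.
- rewrite (partial_y (fun x y => a * F1 x y + b * F2 x y)) !partial_y /dy.
  by rewrite e derive1_lincomb // addr0.
- rewrite (partial_fibre (fun x y => a * F1 x y + b * F2 x y)) //.
  by rewrite !partial_fibre // !mulr0 addr0.
- rewrite (partial_fibre (fun x y => a * F1 x y + b * F2 x y)) //.
  by rewrite !partial_fibre // !mulr0 addr0.
Qed.

Lemma partial_opp F i p : derivable_xy F ->
  partial i (fun q => - F (cx q) (cy q)) p =
    - partial i (fun q => F (cx q) (cy q)) p.
Proof.
move=> dF; have := partial_lincomb (-1) 0 F F i p dF dF.
rewrite mulN1r mul0r addr0 => <-; congr (partial _ _ _).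
by apply/funext => q; ring.
Qed.

Lemma smooth_lincomb (a b : R) f h :
  smooth f -> smooth h -> smooth (fun p => a * f p + b * h p).
Proof.
move=> sf sh l.
have -> : foldr (@partial R) (fun p => a * f p + b * h p) l =
    (a \*: foldr (@partial R) f l) + (b \*: foldr (@partial R) h l).
  elim: l => [|i l IHl] //=; rewrite IHl; apply/funext => p.
  have df := diff_derivable (v := dd R i) (sf l p).
  have dh := diff_derivable (v := dd R i) (sh l p).
  rewrite /partial (deriveD (derivableZ (k := a) df) (derivableZ (k := b) dh)).
  by rewrite (deriveZ a df) (deriveZ b dh).
by move=> p; apply: differentiableD; apply: differentiableZ.
Qed.

Lemma smooth_on_M_lincomb (a b : R) f h :
  smooth_on_M f -> smooth_on_M h -> smooth_on_M (fun p => a * f p + b * h p).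
Proof.
move=> [sf Mf] [sh Mh]; split; first exact: smooth_lincomb.
by move=> j k m n p; rewrite Mf Mh.
Qed.

(** The coordinate components [A] of a closed invariant 1-form: the mixed
    component of its differential in the directions of [x] and of a fibre
    coordinate [i] is [(A i)_x], as [A ix] does not depend on the fibre. *)
Lemma curl_free_fibre_constant (A : 'I_4 -> R -> R -> R) i :
    (forall k l p, partial k (fun q => A l (cx q) (cy q)) p =
                   partial l (fun q => A k (cx q) (cy q)) p) ->
    i != ix -> i != iy -> derivable_xy (A i) ->
  constant2 (A i).
Proof.
move=> curl0 iNx iNy dA; apply: grad_eq0_constant => // x y.
  have := curl0 ix i (at_xy x y).
  by rewrite (partial_x (A i)) (partial_fibre (A ix)) // cx_at cy_at.
have := curl0 iy i (at_xy x y).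
by rewrite (partial_y (A i)) (partial_fibre (A iy)) // cx_at cy_at.
Qed.

(** Both the Lee form [theta] of a metric with constant [h_3], [h_4] and
    [J theta] have this shape.  The term [c * x] comes from
    [e^4 = dz - x dy], and the sign from [e^1 /\ e^2 = dy /\ dx]. *)
Lemma ext_d_affine F1 F2 (a b a' b' c k l : R) (alpha : dform R R 1) :
    derivable_xy F1 -> derivable_xy F2 ->
    (forall p (x := cx p) (y := cy p),
      [/\ alpha p [ffun=> ix] = a * F1 x y + b * F2 x y,
          alpha p [ffun=> iy] = a' * F1 x y + b' * F2 x y + c * x,
          alpha p [ffun=> iz] = k & alpha p [ffun=> iw] = l]) ->
  ext_d alpha = form_scale
    (fun p => a * dy F1 (cx p) (cy p) + b * dy F2 (cx p) (cy p)
      - (a' * dx F1 (cx p) (cy p) + b' * dx F2 (cx p) (cy p) + c))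
    (wedge1 (@cov1 R) (@cov2 R)).
Proof.
move=> dF1 dF2 alphaE.
pose A (i : 'I_4) x y := [:: a * F1 x y + b * F2 x y + 0 * x;
                             a' * F1 x y + b' * F2 x y + c * x; k; l]`_i.
have AE i : (fun q => alpha q [ffun=> i]) = (fun q => A i (cx q) (cy q)).
  apply/funext => q; have [Ex Ey Ez Ew] := alphaE q.
  by move: i; apply: ord4_ind; rewrite /A ?Ex ?Ey ?Ez ?Ew //= mul0r addr0.
apply/funext => p; apply/funext => I; rewrite ext_d1E.
have -> : alpha^~ [ffun=> I ord_max] = (fun q => A (I ord_max) (cx q) (cy q)).
  exact: AE.
have -> : alpha^~ [ffun=> I ord0] = (fun q => A (I ord0) (cx q) (cy q)).
  exact: AE.
rewrite /form_scale wedge11E /cov1 /cov2 /dcoord !ffunE.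
set K := (X in X * _).
apply/eqP; rewrite -subr_eq0; apply/eqP.
move: (I ord0) (I ord_max); apply: alternating2_eq0 => [i j||||||] /=.
- by ring.
- rewrite (partial_x (A iy)) (partial_y (A ix)) /A /=.
  by rewrite dx_lincomb // dy_lincomb // /K; ring.
- rewrite (partial_x (A iz)) (partial_fibre (A ix)) // /A /=.
  by rewrite /dx (derive1_cst (V := R)); ring.
- rewrite (partial_x (A iw)) (partial_fibre (A ix)) // /A /=.
  by rewrite /dx (derive1_cst (V := R)); ring.
- rewrite (partial_y (A iz)) (partial_fibre (A iy)) // /A /=.
  by rewrite /dy (derive1_cst (V := R)); ring.
- rewrite (partial_y (A iw)) (partial_fibre (A iy)) // /A /=.
  by rewrite /dy (derive1_cst (V := R)); ring.
- by rewrite (partial_fibre (A iz)) // (partial_fibre (A iw)) //; ring.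
Qed.

End InvariantFunctions.

(** * The coframe, J and the invariant pairings *)

Section Pairings.
Context {R : realType}.
Implicit Types (p v w : 'rV[R]_4) (g : 'rV[R]_4 -> 'M[R]_4).

Lemma ddE (i j : 'I_4) : dd R i 0 j = (i == j)%:R.
Proof. by rewrite mxE eqxx eq_sym. Qed.

Lemma rV4E v : v = v 0 ix *: dd R ix + v 0 iy *: dd R iy
                   + v 0 iz *: dd R iz + v 0 iw *: dd R iw.
Proof.
by rewrite -(sum_ord4 _ (fun i => v 0 i *: dd R i)) -row_sum_delta.
Qed.

Lemma eval1_dd (a : dform R R 1) p i : eval1 a p (dd R i) = a p [ffun=> i].
Proof.
rewrite /eval1 (bigD1 i) //= ddE eqxx mul1r big1 ?addr0 // => j /negPf nij.
by rewrite ddE eq_sym nij mul0r.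
Qed.

Lemma eval_cov1 p v : eval1 (@cov1 R) p v = v 0 iy.
Proof. by rewrite /eval1 sum_ord4 /cov1 /dcoord !ffunE /=; ring. Qed.

Lemma eval_cov2 p v : eval1 (@cov2 R) p v = v 0 ix.
Proof. by rewrite /eval1 sum_ord4 /cov2 /dcoord !ffunE /=; ring. Qed.

Lemma eval_cov3 p v : eval1 (@cov3 R) p v = v 0 iw.
Proof. by rewrite /eval1 sum_ord4 /cov3 /dcoord !ffunE /=; ring. Qed.

Lemma eval_cov4 p v : eval1 (@cov4 R) p v = v 0 iz - cx p * v 0 iy.
Proof.
rewrite /eval1 sum_ord4 /cov4 /form_add /form_scale /dcoord !ffunE /=; ring.
Qed.

Lemma J_coord p v :
  [/\ J p v 0 ix = v 0 iy, J p v 0 iy = - v 0 ix,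
      J p v 0 iz = v 0 iw - cx p * v 0 ix
    & J p v 0 iw = cx p * v 0 iy - v 0 iz].
Proof.
rewrite /J /vec1 /vec2 /vec3 /vec4 eval_cov1 eval_cov2 eval_cov3 eval_cov4.
by split; rewrite !mxE /=; ring.
Qed.

Lemma J_add p v w : J p (v + w) = J p v + J p w.
Proof.
apply/rowP; have [Jx Jy Jz Jw] := J_coord p (v + w).
have [vx vy vz vw] := J_coord p v; have [wx wy wz ww] := J_coord p w.
by apply: ord4_ind; rewrite [RHS]mxE ?Jx ?Jy ?Jz ?Jw ?vx ?vy ?vz ?vw
   ?wx ?wy ?wz ?ww !mxE; ring.
Qed.

Lemma J_scale p c v : J p (c *: v) = c *: J p v.
Proof.
apply/rowP; have [Jx Jy Jz Jw] := J_coord p (c *: v).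
have [vx vy vz vw] := J_coord p v.
by apply: ord4_ind; rewrite [RHS]mxE ?Jx ?Jy ?Jz ?Jw ?vx ?vy ?vz ?vw
   !mxE; ring.
Qed.

Lemma gdot_dd g p i j : gdot g p (dd R i) (dd R j) = g p i j.
Proof. by rewrite /gdot /dd -rowE trmx_delta -colE !mxE. Qed.

Lemma gdot_ddr g p v j : gdot g p v (dd R j) = (v *m g p) 0 j.
Proof. by rewrite /gdot /dd trmx_delta -colE mxE. Qed.

Lemma gdotDl g p v1 v2 v : gdot g p (v1 + v2) v = gdot g p v1 v + gdot g p v2 v.
Proof. by rewrite /gdot !mulmxDl mxE. Qed.

Lemma gdotZl g p c v1 v : gdot g p (c *: v1) v = c * gdot g p v1 v.
Proof. by rewrite /gdot -!scalemxAl mxE. Qed.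

Lemma gdotDr g p v1 v2 v : gdot g p v (v1 + v2) = gdot g p v v1 + gdot g p v v2.
Proof. by rewrite /gdot linearD mulmxDr mxE. Qed.

Lemma gdotZr g p c v1 v : gdot g p v (c *: v1) = c * gdot g p v v1.
Proof. by rewrite /gdot linearZ -scalemxAr mxE. Qed.

(** The value on [(v, w)], at a point with first coordinate [x], of the 2-form
      r e^12 + s e^34 + a (e^13 + e^24) + b (e^14 - e^23). *)
Definition omega_pairing (r s a b x : R) v w : R :=
  let e1 v := v 0 iy in let e2 v := v 0 ix in
  let e3 v := v 0 iw in let e4 v := v 0 iz - x * v 0 iy in
  r * (e1 v * e2 w - e2 v * e1 w) + s * (e3 v * e4 w - e4 v * e3 w)
  + a * (e1 v * e3 w - e3 v * e1 w + e2 v * e4 w - e4 v * e2 w)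
  + b * (e1 v * e4 w - e4 v * e1 w - e2 v * e3 w + e3 v * e2 w).

(** The metric determined by [omega_pairing], with value [omega(v, J w)]. *)
Definition metric_pairing (r s a b x : R) v w : R :=
  let e1 v := v 0 iy in let e2 v := v 0 ix in
  let e3 v := v 0 iw in let e4 v := v 0 iz - x * v 0 iy in
  r * (e1 v * e1 w + e2 v * e2 w) + s * (e3 v * e3 w + e4 v * e4 w)
  + a * (e2 v * e3 w + e3 v * e2 w - e1 v * e4 w - e4 v * e1 w)
  + b * (e1 v * e3 w + e3 v * e1 w + e2 v * e4 w + e4 v * e2 w).

Lemma re_omega_rsu r s u p (I : {ffun 'I_2 -> 'I_4}) :
  complex.Re (omega_rsu r s u p I) =
    omega_pairing (r (cx p) (cy p)) s (u1 u (cx p) (cy p)) (u2 u (cx p) (cy p))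
                  (cx p) (dd R (I ord0)) (dd R (I ord_max)).
Proof.
rewrite /omega_pairing -!(eval_cov4 p) -!(eval_cov1 p) -!(eval_cov2 p).
rewrite -!(eval_cov3 p) !eval1_dd.
(* [2^-1] is made an explicit pair so that real parts compute. *)
have i2 : (2^-1 : R[i]) = Complex (2^-1) 0.
  by rewrite -[RHS]/((2^-1)%:C%C) fmorphV rmorph_nat.
rewrite /omega_rsu /form_add /form_scale !wedge11E /conj_form /phi1 /phi2.
by rewrite /u1 /u2 i2; case: (u _ _) => a b /=; field.
Qed.

Section DerivablePairings.
Context (r : R -> R -> R) (s : R) (a b : R -> R -> R).
Context (dr : derivable_xy r) (da : derivable_xy a) (db : derivable_xy b).

Lemma derivable_omega_pairing v w :
  derivable_xy (fun x y => omega_pairing (r x y) s (a x y) (b x y) x v w).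
Proof. split=> x y; cbv beta delta [omega_pairing] zeta; derivable_poly. Qed.

Lemma derivable_metric_pairing v w :
  derivable_xy (fun x y => metric_pairing (r x y) s (a x y) (b x y) x v w).
Proof. split=> x y; cbv beta delta [metric_pairing] zeta; derivable_poly. Qed.

End DerivablePairings.

End Pairings.

(** * The Lee form and the Vaisman condition *)

Section Metric.
Context {R : realType} (g : 'rV[R]_4 -> 'M[R]_4).
Context (r : R -> R -> R) (s : R) (u : R -> R -> R[i]).
Context (g_hermitian : hermitian_metric g).
Context (g_omega : cplx (fundamental_form g) = omega_rsu r s u).
Implicit Types (p v w : 'rV[R]_4).

Let omega_at x y := omega_pairing (r x y) s (u1 u x y) (u2 u x y) x.
Let metric_at x y := metric_pairing (r x y) s (u1 u x y) (u2 u x y) x.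

Lemma gdot_J_E p v w : gdot g p (J p v) w = omega_at (cx p) (cy p) v w.
Proof.
have base i j : gdot g p (J p (dd R i)) (dd R j) =
    omega_at (cx p) (cy p) (dd R i) (dd R j).
  pose I : {ffun 'I_2 -> 'I_4} := [ffun k => if k == ord0 then i else j].
  have := congr1 (fun a => complex.Re (a p I)) g_omega.
  by rewrite re_omega_rsu /cplx /fundamental_form !ffunE.
rewrite [in LHS](rV4E v) !J_add !J_scale !gdotDl !gdotZl.
rewrite [in LHS](rV4E w) !gdotDr !gdotZr !base.
by rewrite /omega_at /omega_pairing !ddE /=; ring.
Qed.

Lemma gdotE p v w : gdot g p v w = metric_at (cx p) (cy p) v w.
Proof.
have [_ _ _ gJ] := g_hermitian.
rewrite -gJ gdot_J_E /omega_at /omega_pairing /metric_at /metric_pairing.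
by have [-> -> -> ->] := J_coord p w; ring.
Qed.

Lemma discE x y : disc r s u x y = r x y * s - (u1 u x y ^+ 2 + u2 u x y ^+ 2).
Proof.
rewrite /disc /u1 /u2; case: (u x y) => a b /=.
by rewrite sqr_sqrtr ?addr_ge0 ?sqr_ge0.
Qed.

Lemma s_gt0 : 0 < s.
Proof.
have [_ _ pos _] := g_hermitian.
have : 0 < gdot g 0 (dd R iw) (dd R iw).
  apply: pos; apply/eqP => /rowP /(_ iw); rewrite ddE mxE /= => /eqP.
  by rewrite oner_eq0.
by rewrite gdotE /metric_at /metric_pairing !ddE /=; congr (_ < _); ring.
Qed.

Let s_neq0 : s != 0 := lt0r_neq0 s_gt0.

Lemma disc_gt0 x y : 0 < disc r s u x y.
Proof.
have [_ _ pos _] := g_hermitian; pose p := at_xy x y.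
(* [v] is [s] times the component of [e_1] orthogonal to [e_3] and [e_4]. *)
pose v := s *: vec1 p - u2 u x y *: vec3 p + u1 u x y *: vec4 p.
have : 0 < gdot g p v v.
  apply: pos; apply/eqP => /rowP /(_ iy).
  rewrite !mxE /= => /eqP; apply/negP; rewrite gt_eqF //.
  by rewrite (_ : _ + _ = s) ?s_gt0 //; ring.
have -> : gdot g p v v = s * disc r s u x y.
  rewrite gdotE discE /metric_at /metric_pairing /v /vec1 /vec3 /vec4.
  by rewrite cx_at cy_at !mxE /=; ring.
by rewrite pmulr_rgt0 // s_gt0.
Qed.

Let disc_neq0 x y : disc r s u x y != 0 := lt0r_neq0 (disc_gt0 x y).

Lemma derivable_metric_component F a b :
    (forall p, gdot g p (frame a p) (frame b p) = F (cx p) (cy p)) ->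
  derivable_xy F.
Proof.
have [/(_ a b) [sm _] _ _ _] := g_hermitian => FE.
apply: differentiable_derivable_xy => p.
by have := sm [::] p; rewrite (funext FE).
Qed.

Lemma derivable_r : derivable_xy r.
Proof.
apply: (derivable_metric_component r iy iy) => p.
by rewrite gdotE /metric_at /metric_pairing /frame /= /vec2 !mxE /=; ring.
Qed.

Lemma derivable_u1 : derivable_xy (u1 u).
Proof.
apply: (derivable_metric_component (u1 u) iy iz) => p.
rewrite gdotE /metric_at /metric_pairing /frame /= /vec2 /vec3 !mxE /=; ring.
Qed.

Lemma derivable_u2 : derivable_xy (u2 u).
Proof.
apply: (derivable_metric_component (u2 u) ix iz) => p.
rewrite gdotE /metric_at /metric_pairing /frame /= /vec1 /vec3 !mxE /=; ring.
Qed.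

Let dr := derivable_r.
Let du1 := derivable_u1.
Let du2 := derivable_u2.

Definition omega_coord x y i j := omega_at x y (dd R i) (dd R j).

Lemma omega_coord_skew x y i j : omega_coord x y i j = - omega_coord x y j i.
Proof. by rewrite /omega_coord /omega_at /omega_pairing; ring. Qed.

Lemma omega_coordE x y :
  [/\ omega_coord x y ix iy = - (r x y + x * u1 u x y),
      omega_coord x y ix iz = u1 u x y & omega_coord x y ix iw = - u2 u x y] /\
  [/\ omega_coord x y iy iz = u2 u x y,
      omega_coord x y iy iw = u1 u x y + s * x & omega_coord x y iz iw = - s].
Proof.
by rewrite /omega_coord /omega_at /omega_pairing !ddE /=; do !split; ring.
Qed.

Lemma derivable_omega_coord i j : derivable_xy (fun x y => omega_coord x y i j).
Proof. exact: derivable_omega_pairing. Qed.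

Lemma partial_omega_coord p :
  [/\ partial ix (fun q => omega_coord (cx q) (cy q) iy iz) p =
        dx (u2 u) (cx p) (cy p),
      partial iy (fun q => omega_coord (cx q) (cy q) ix iz) p =
        dy (u1 u) (cx p) (cy p),
      partial ix (fun q => omega_coord (cx q) (cy q) iy iw) p =
        dx (u1 u) (cx p) (cy p) + s
    & partial iy (fun q => omega_coord (cx q) (cy q) ix iw) p =
        - dy (u2 u) (cx p) (cy p)].
Proof.
have coordE i j F : (forall x y, omega_coord x y i j = F x y) ->
    (fun q : 'rV[R]_4 => omega_coord (cx q) (cy q) i j) =
    (fun q => F (cx q) (cy q)).
  by move=> FE; apply/funext => q; exact: FE.
split.
- rewrite (coordE _ _ (u2 u)) ?partial_x // => x y.
  by have [_ [-> _ _]] := omega_coordE x y.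
- rewrite (coordE _ _ (u1 u)) ?partial_y // => x y.
  by have [[_ -> _] _] := omega_coordE x y.
- rewrite (coordE _ _ (fun x y => 1 * u1 u x y + 0 * u2 u x y + s * x)).
    rewrite (partial_x (fun x y => 1 * u1 u x y + 0 * u2 u x y + s * x)).
    by rewrite dx_lincomb // mul1r mul0r addr0.
  by move=> x y; have [_ [_ -> _]] := omega_coordE x y; ring.
- rewrite (coordE _ _ (fun x y => 0 * u1 u x y + -1 * u2 u x y + 0 * x)).
    rewrite (partial_y (fun x y => 0 * u1 u x y + -1 * u2 u x y + 0 * x)).
    by rewrite dy_lincomb // mul0r add0r mulN1r.
  by move=> x y; have [[_ _ ->] _] := omega_coordE x y; ring.
Qed.

Lemma partial_omega_zw p i :
  partial i (fun q => omega_coord (cx q) (cy q) iz iw) p = 0.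
Proof.
have -> : (fun q : 'rV[R]_4 => omega_coord (cx q) (cy q) iz iw) = cst (- s).
  by apply/funext => q; have [_ [_ _ ->]] := omega_coordE (cx q) (cy q).
exact: derive_cst.
Qed.

Definition lee_vector p : 'rV[R]_4 :=
  (h3 r s u (cx p) (cy p) / s) *: vec3 p
  + (h4 r s u (cx p) (cy p) / s) *: vec4 p.

(** The components of the form dual to [lee_vector]; those in the directions of
    [z] and [w] are [h_4] and [h_3], as [e_4] and [e_3] have square length
    [s]. *)
Definition lee_coord (i : 'I_4) (x y : R) : R :=
  [:: h3 r s u x y / s * u1 u x y + h4 r s u x y / s * u2 u x y;
      h3 r s u x y / s * u2 u x y - h4 r s u x y / s * (u1 u x y + s * x);
      h4 r s u x y; h3 r s u x y]`_i.

Lemma gdot_lee_vector p i :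
  gdot g p (lee_vector p) (dd R i) = lee_coord i (cx p) (cy p).
Proof.
rewrite gdotE /metric_at /metric_pairing /lee_vector /vec3 /vec4.
by move: i; apply: ord4_ind; rewrite !mxE /lee_coord /=; field.
Qed.

(** Both sides are 3-forms, so only the four increasing multi-indices count.
    The components [xzw] and [yzw] of [d omega] vanish and give [theta_x] and
    [theta_y] in terms of [theta_z] and [theta_w]; substituting these in the
    other two components decouples [theta_z] and [theta_w], each with
    coefficient [(r s - |u|^2) / s]. *)
Lemma lee_equationP (theta : dform R R 1) :
  ext_d (fundamental_form g) = wedge1 theta (fundamental_form g) <->
  forall p i, theta p [ffun=> i] = lee_coord i (cx p) (cy p).
Proof.
pose O p i j := omega_coord (cx p) (cy p) i j.
pose F p i j k :=
  (partial i (fun q => O q j k) p - partial j (fun q => O q i k) p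
   + partial k (fun q => O q i j) p)
  - (theta p [ffun=> i] * O p j k - theta p [ffun=> j] * O p i k
     + theta p [ffun=> k] * O p i j).
have OE p I : fundamental_form g p I = O p (I ord0) (I ord_max).
  by rewrite /fundamental_form gdot_J_E.
have FE : ext_d (fundamental_form g) = wedge1 theta (fundamental_form g) <->
    forall p i j k, F p i j k = 0.
  split=> [dO p i j k | F0].
    pose I := [ffun m : 'I_3 => tnth [tuple i; j; k] m].
    have := congr1 (fun a => a p I) dO.
    rewrite (ext_d2E _ _ O) // (wedge12E _ _ _ O) // /I !ffunE /=.
    by move/eqP; rewrite -subr_eq0 => /eqP.
  apply/funext => p; apply/funext => I.
  rewrite (ext_d2E _ _ O) // (wedge12E _ _ _ O) //.
  by apply/eqP; rewrite -subr_eq0; apply/eqP; apply: F0.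
apply: (iff_trans FE).
have FxyzE p (x := cx p) (y := cy p) :
    F p ix iy iz = dx (u2 u) x y - dy (u1 u) x y
      - (theta p [ffun=> ix] * u2 u x y - theta p [ffun=> iy] * u1 u x y
         - theta p [ffun=> iz] * (r x y + x * u1 u x y)).
  rewrite /F /O; have [-> -> _ _] := partial_omega_coord p.
  have [[-> -> _] [-> _ _]] := omega_coordE x y.
  rewrite (partial_fibre (fun x y => omega_coord x y ix iy)) // -/x -/y; ring.
have FxywE p (x := cx p) (y := cy p) :
    F p ix iy iw = dx (u1 u) x y + s + dy (u2 u) x y
      - (theta p [ffun=> ix] * (u1 u x y + s * x)
         + theta p [ffun=> iy] * u2 u x y
         - theta p [ffun=> iw] * (r x y + x * u1 u x y)).
  rewrite /F /O; have [_ _ -> ->] := partial_omega_coord p.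
  have [[-> _ ->] [_ -> _]] := omega_coordE x y.
  rewrite (partial_fibre (fun x y => omega_coord x y ix iy)) // -/x -/y; ring.
have FxzwE p (x := cx p) (y := cy p) :
    F p ix iz iw = s * theta p [ffun=> ix] - theta p [ffun=> iz] * u2 u x y
      - theta p [ffun=> iw] * u1 u x y.
  rewrite /F /O partial_omega_zw.
  rewrite (partial_fibre (fun x y => omega_coord x y ix iw)) //.
  rewrite (partial_fibre (fun x y => omega_coord x y ix iz)) //.
  have [[_ -> ->] [_ _ ->]] := omega_coordE x y; ring.
have FyzwE p (x := cx p) (y := cy p) :
    F p iy iz iw = s * theta p [ffun=> iy]
      + theta p [ffun=> iz] * (u1 u x y + s * x)
      - theta p [ffun=> iw] * u2 u x y.
  rewrite /F /O partial_omega_zw.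
  rewrite (partial_fibre (fun x y => omega_coord x y iy iw)) //.
  rewrite (partial_fibre (fun x y => omega_coord x y iy iz)) //.
  have [_ [-> -> ->]] := omega_coordE x y; ring.
split=> [F0 p | thetaE].
  have := F0 p ix iy iz; have := F0 p ix iy iw.
  have := F0 p ix iz iw; have := F0 p iy iz iw.
  rewrite FxyzE FxywE FxzwE FyzwE.
  set x := cx p; set y := cy p.
  set tx := theta p [ffun=> ix]; set ty := theta p [ffun=> iy].
  set tz := theta p [ffun=> iz]; set tw := theta p [ffun=> iw].
  move=> Ey Ex Ew Ez.
  have txE : tx = (tz * u2 u x y + tw * u1 u x y) / s.
    apply: (mulfI s_neq0); rewrite mulrCA divff // mulr1.
    by rewrite -[RHS]addr0 -[X in _ = _ + X]Ex; ring.
  have tyE : ty = (tw * u2 u x y - tz * (u1 u x y + s * x)) / s.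
    apply: (mulfI s_neq0); rewrite mulrCA divff // mulr1.
    by rewrite -[RHS]addr0 -[X in _ = _ + X]Ey; ring.
  have d0 := disc_neq0 x y; have dE := discE x y.
  have twE : tw = h3 r s u x y.
    apply: (mulfI d0); apply/eqP; rewrite -subr_eq0; apply/eqP.
    transitivity (s * 0); last exact: mulr0.
    have -> : disc r s u x y * h3 r s u x y =
        s * (- s - dx (u1 u) x y - dy (u2 u) x y) by rewrite /h3; field.
    by rewrite -Ew txE tyE dE; field.
  have tzE : tz = h4 r s u x y.
    apply: (mulfI d0); apply/eqP; rewrite -subr_eq0; apply/eqP.
    transitivity (s * 0); last exact: mulr0.
    have -> : disc r s u x y * h4 r s u x y =
        s * (dy (u1 u) x y - dx (u2 u) x y) by rewrite /h4; field.
    by rewrite -Ez txE tyE dE; field.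
  apply: ord4_ind; rewrite /lee_coord /= -?twE -?tzE //.
    by rewrite -/tx txE; field.
  by rewrite -/ty tyE; field.
have skewO i j k p : partial k (fun q => O q i j) p =
    - partial k (fun q => O q j i) p.
  rewrite -(partial_opp (fun x y => omega_coord x y j i)).
    congr (partial _ _ _); apply/funext => q; exact: omega_coord_skew.
  exact: derivable_omega_coord.
have alt12 p i j k : F p i j k = - F p j i k.
  by rewrite /F (skewO i j k) /O (omega_coord_skew _ _ i j); ring.
have alt23 p i j k : F p i j k = - F p i k j.
  by rewrite /F (skewO j k i) /O (omega_coord_skew _ _ j k); ring.
move=> p; have d0 := disc_neq0 (cx p) (cy p).
(* Eliminating [r] leaves [disc] as an atom, so that [field] only has to know
   that [s] and [disc] are nonzero. *)
have rE : r (cx p) (cy p) = (disc r s u (cx p) (cy p)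
    + (u1 u (cx p) (cy p) ^+ 2 + u2 u (cx p) (cy p) ^+ 2)) / s.
  by rewrite discE; field.
apply: alternating3_eq0 => //.
- by rewrite FxyzE !thetaE /lee_coord /= /h3 /h4 rE; field; rewrite s_neq0.
- by rewrite FxywE !thetaE /lee_coord /= /h3 /h4 rE; field; rewrite s_neq0.
- by rewrite FxzwE !thetaE /lee_coord /=; field.
- by rewrite FyzwE !thetaE /lee_coord /=; field.
Qed.

Lemma gdot_nondegenerate p w : (forall v, gdot g p w v = 0) -> w = 0.
Proof.
move=> w0; apply/eqP/negPn/negP => wN0; have [_ _ pos _] := g_hermitian.
by have := pos p w wN0; rewrite w0 ltxx.
Qed.

Lemma metric_unitmx p : g p \in unitmx.
Proof.
rewrite -row_free_unit; apply: inj_row_free => v vg0.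
by apply: (gdot_nondegenerate p) => w; rewrite /gdot vg0 mul0mx mxE.
Qed.

Section LeeForm.
Context (theta : dform R R 1).
Context (thetaE : forall p i, theta p [ffun=> i] = lee_coord i (cx p) (cy p)).

Lemma eval1_lee p v : eval1 theta p v = gdot g p (lee_vector p) v.
Proof.
rewrite {2}(rV4E v) !gdotDr !gdotZr /eval1 sum_ord4.
by rewrite !gdot_lee_vector !thetaE.
Qed.

Lemma lee_vector_fieldP (T : 'rV[R]_4 -> 'rV[R]_4) :
  lee_vector_field g theta T <-> forall p, T p = lee_vector p.
Proof.
split=> [TE p | TE p v]; last by rewrite TE eval1_lee.
apply/eqP; rewrite -subr_eq0; apply/eqP.
apply: (gdot_nondegenerate p) => v; rewrite -scaleN1r gdotDl gdotZl.
by rewrite TE eval1_lee mulN1r subrr.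
Qed.

Lemma closed_lee_constant : smooth_form1 theta ->
    ext_d theta = (fun _ _ => 0) ->
  constant2 (h3 r s u) /\ constant2 (h4 r s u).
Proof.
move=> smooth_theta dtheta0.
have derivable_coord i a : (forall p, frame a p = dd R i) ->
    derivable_xy (lee_coord i).
  move=> ai; apply: differentiable_derivable_xy => p.
  have [/(_ [::] p) + _] := smooth_theta a.
  rewrite /= (_ : (fun q => _) = fun q => lee_coord i (cx q) (cy q)) //.
  by apply/funext => q; rewrite ai eval1_dd thetaE.
have dtheta i j p : partial i (fun q => lee_coord j (cx q) (cy q)) p =
                    partial j (fun q => lee_coord i (cx q) (cy q)) p.
  have coordE k : (fun q => lee_coord k (cx q) (cy q)) = theta^~ [ffun=> k].
    by apply/funext => q; rewrite thetaE.
  pose I : {ffun 'I_2 -> 'I_4} := [ffun k => if k == ord0 then i else j].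
  have := congr1 (fun a => a p I) dtheta0.
  by rewrite ext_d1E !ffunE /= !coordE => /eqP; rewrite subr_eq0 => /eqP.
have h3_coord : h3 r s u = lee_coord iw by [].
have h4_coord : h4 r s u = lee_coord iz by [].
(* [frame] is indexed from 0: its entries at [iz] and [iw] are [e_3] and [e_4],
   the coordinate fields of [w] and [z]. *)
have d3 : derivable_xy (lee_coord iw) by exact: (derivable_coord iw iz).
have d4 : derivable_xy (lee_coord iz) by exact: (derivable_coord iz iw).
rewrite h3_coord h4_coord; split.
  exact: (curl_free_fibre_constant lee_coord iw dtheta isT isT d3).
exact: (curl_free_fibre_constant lee_coord iz dtheta isT isT d4).
Qed.

Section Constant.
Context (c3 c4 : R) (h3E : forall x y, h3 r s u x y = c3)
        (h4E : forall x y, h4 r s u x y = c4).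

Lemma h3_disc x y :
  c3 * disc r s u x y = s * (- s - dx (u1 u) x y - dy (u2 u) x y).
Proof. by rewrite -(h3E x y) /h3; field. Qed.

Lemma h4_disc x y :
  c4 * disc r s u x y = s * (dy (u1 u) x y - dx (u2 u) x y).
Proof. by rewrite -(h4E x y) /h4; field. Qed.

Lemma ext_d_lee : ext_d theta = (fun _ _ => 0).
Proof.
rewrite (ext_d_affine (u1 u) (u2 u) (c3 / s) (c4 / s) (- (c4 / s)) (c3 / s)
   (- c4) c4 c3) //.
  apply/funext => p; apply/funext => I; rewrite /form_scale.
  set x := cx p; set y := cy p; set e := (X in X * _).
  suff -> : e = 0 by rewrite mul0r.
  apply: (mulfI s_neq0); apply: (mulfI (disc_neq0 x y)); rewrite !mulr0.
  have := h3_disc x y; have := h4_disc x y; rewrite /e.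
  set a1 := dx (u1 u) x y; set a2 := dx (u2 u) x y.
  set b1 := dy (u1 u) x y; set b2 := dy (u2 u) x y.
  set D := disc _ _ _ _ _ => E4 E3.
  transitivity (c3 * D * (b1 - a2) - c4 * D * (- s - a1 - b2)).
    by field.
  by rewrite E3 E4; ring.
move=> p x y; split; rewrite thetaE /lee_coord /= ?h3E ?h4E -/x -/y //; by field.
Qed.

Lemma ext_d_J_lee :
  ext_d (Jform theta) =
    form_scale (fun p => - (s ^+ 2)^-1 * (c3 ^+ 2 + c4 ^+ 2)
                         * disc r s u (cx p) (cy p))
               (wedge1 (@cov1 R) (@cov2 R)).
Proof.
rewrite (ext_d_affine (u1 u) (u2 u) (- (c4 / s)) (c3 / s) (- (c3 / s))
   (- (c4 / s)) (- c3) c3 (- c4)) //.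
  congr (form_scale _ _); apply/funext => p.
  have := h3_disc (cx p) (cy p); have := h4_disc (cx p) (cy p).
  set x := cx p; set y := cy p.
  set a1 := dx (u1 u) x y; set a2 := dx (u2 u) x y.
  set b1 := dy (u1 u) x y; set b2 := dy (u2 u) x y.
  set D := disc _ _ _ _ _ => E4 E3.
  transitivity (- (s ^+ 2)^-1 * (c3 * (c3 * D) + c4 * (c4 * D))); last by ring.
  by rewrite E3 E4; field.
move=> p x y; rewrite /Jform !eval1_lee /vec1 /vec2 /vec3 /vec4 !gdotDr !gdotZr.
rewrite !gdot_lee_vector /lee_coord /= !h3E !h4E.
rewrite /cov1 /cov2 /cov3 /cov4 /form_add /form_scale /dcoord !ffunE /=.
by split; rewrite -/x -/y; field.
Qed.

(** Contracting the Christoffel symbols with [theta] cancels the inverse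
    metric: [sum_k Gamma^k_ij theta_k] is half of
      sum_l T^l (d_i g_jl + d_j g_il - d_l g_ij).
    As [T] has constant coordinates and points along the fibre, on which the
    metric does not depend, this is half of [d_i theta_j + d_j theta_i]. *)
Lemma nabla_lee p i j : nabla g theta p i j = 0.
Proof.
pose T : 'rV[R]_4 := (c3 / s) *: dd R iw + (c4 / s) *: dd R iz.
have TE q : lee_vector q = T by rewrite /T /lee_vector h3E h4E.
have symg q k l : g q k l = g q l k.
  by have [_ gC _ _] := g_hermitian; rewrite -!gdot_dd gC.
pose S l := partial i (fun q => g q j l) p + partial j (fun q => g q i l) p
     - partial l (fun q => g q i j) p.
have gammaE : \sum_k christoffel g p k i j * theta p [ffun=> k] =
    2^-1 * \sum_l T 0 l * S l.
  have thetaT k : theta p [ffun=> k] = (T *m g p) 0 k.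
    by rewrite -gdot_ddr -(TE p) -eval1_lee eval1_dd.
  have -> : T = T *m g p *m invmx (g p) by rewrite mulmxK // metric_unitmx.
  rewrite mulr_sumr.
  under eq_bigr do rewrite /christoffel -mulrA mulr_suml mulr_sumr.
  rewrite exchange_big /=; apply: eq_bigr => l _.
  rewrite mxE mulr_suml mulr_sumr; apply: eq_bigr => k _.
  by rewrite thetaT /S; ring.
pose met k l x y := metric_at x y (dd R k) (dd R l).
have dmet k l : derivable_xy (met k l) by exact: derivable_metric_pairing.
have metE q k l : g q k l = met k l (cx q) (cy q) by rewrite -gdot_dd gdotE.
have gE k l : (fun q => g q k l) = (fun q => met k l (cx q) (cy q)).
  by apply/funext => q; exact: metE.
have fibre k l m : m != ix -> m != iy -> partial m (fun q => g q k l) p = 0.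
  by move=> mNx mNy; rewrite gE (partial_fibre (met k l)).
have dtheta k m : partial m (theta^~ [ffun=> k]) p =
    c3 / s * partial m (fun q => g q k iw) p
    + c4 / s * partial m (fun q => g q k iz) p.
  rewrite !gE -(partial_lincomb _ _ _ _ m p (dmet k iw) (dmet k iz)).
  congr (partial _ _ _); apply/funext => q.
  by rewrite -eval1_dd eval1_lee TE /T gdotDl !gdotZl !gdot_dd !(symg q _ k) !metE.
have closed :
    partial i (theta^~ [ffun=> j]) p = partial j (theta^~ [ffun=> i]) p.
  pose I : {ffun 'I_2 -> 'I_4} := [ffun k => if k == ord0 then i else j].
  have := congr1 (fun a => a p I) ext_d_lee.
  by rewrite ext_d1E !ffunE /= => /eqP; rewrite subr_eq0 => /eqP.
rewrite /nabla gammaE sum_ord4.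
have -> : T 0 ix = 0 by rewrite !mxE /=; ring.
have -> : T 0 iy = 0 by rewrite !mxE /=; ring.
have -> : T 0 iz = c4 / s by rewrite !mxE /=; ring.
have -> : T 0 iw = c3 / s by rewrite !mxE /=; ring.
have := closed; rewrite !dtheta /S.
rewrite (fibre _ _ iz isT isT) (fibre _ _ iw isT isT) => E.
set A := _ + _ in E; set B := _ + _ in E.
transitivity (A - 2^-1 * (A + B)); first by rewrite /A /B; ring.
by rewrite E; field.
Qed.

End Constant.
End LeeForm.

Lemma vaisman_constant : vaisman g ->
  constant2 (h3 r s u) /\ constant2 (h4 r s u).
Proof.
move=> [theta [[smooth_theta /lee_equationP thetaE] closed _]].
exact: (closed_lee_constant theta thetaE smooth_theta closed).
Qed.

Lemma constant_vaisman : constant2 (h3 r s u) -> constant2 (h4 r s u) ->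
  vaisman g.
Proof.
move=> [c3 h3E] [c4 h4E].
pose theta : dform R R 1 := fun p I => gdot g p (lee_vector p) (dd R (I ord0)).
have thetaE p i : theta p [ffun=> i] = lee_coord i (cx p) (cy p).
  by rewrite /theta ffunE gdot_lee_vector.
exists theta; split.
- split; last exact/lee_equationP.
  have [smooth_g _ _ _] := g_hermitian => i.
  rewrite (_ : (fun p => _) = fun p =>
      c3 / s * gdot g p (frame iz p) (frame i p)
      + c4 / s * gdot g p (frame iw p) (frame i p)).
    exact: smooth_on_M_lincomb.
  apply/funext => p.
  by rewrite (eval1_lee theta thetaE) /lee_vector gdotDl !gdotZl h3E h4E.
- exact: (ext_d_lee theta thetaE c3 c4 h3E h4E).
- exact: (nabla_lee theta thetaE c3 c4 h3E h4E).
Qed.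

End Metric.

Theorem theorem3p1 (R : realType) (g : 'rV[R]_4 -> 'M[R]_4)
    (r : R -> R -> R) (s : R) (u : R -> R -> R[i])
    (g_hermitian : hermitian_metric g)
    (g_invariant : T2_invariant g)
    (g_pluriclosed : pluriclosed g)
    (g_omega : cplx (fundamental_form g) = omega_rsu r s u) :
  (vaisman g <-> constant2 (h3 r s u) /\ constant2 (h4 r s u)) /\
  (forall theta : dform R R 1, vaisman g -> lee_form g theta ->
     (forall T : 'rV[R]_4 -> 'rV[R]_4,
        lee_vector_field g theta T <->
        forall p, T p = (h3 r s u (cx p) (cy p) / s) *: vec3 p
                      + (h4 r s u (cx p) (cy p) / s) *: vec4 p) /\
     ext_d (Jform theta) =
       form_scale
         (fun p => - (s ^+ 2)^-1
            * (h3 r s u (cx p) (cy p) ^+ 2 + h4 r s u (cx p) (cy p) ^+ 2)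
            * disc r s u (cx p) (cy p))
         (wedge1 (@cov1 R) (@cov2 R))).
Proof.
have constant := vaisman_constant g r s u g_hermitian g_omega.
split.
  split=> [// | [const3 const4]].
  exact: (constant_vaisman g r s u g_hermitian g_omega const3 const4).
move=> theta vaisman_g [_ lee_theta].
have thetaE := (lee_equationP g r s u g_hermitian g_omega theta).1 lee_theta.
split=> [T|].
  exact: (lee_vector_fieldP g r s u g_hermitian g_omega theta thetaE T).
have [[c3 h3E] [c4 h4E]] := constant vaisman_g.
rewrite (ext_d_J_lee g r s u g_hermitian g_omega theta thetaE c3 c4 h3E h4E).
by congr (form_scale _ _); apply/funext => p; rewrite h3E h4E.
Qed.
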